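(* Let $(E,\tau)$ be a locally convex space over $K$. If $B$ is a convex subset of $E$, then the closure of $B$ in the topology $\sigma(E,\delta\text{-}E^{*})$ equals the $\delta$-closure of $B$ with respect to $\tau$: $\operatorname{cl}_{\sigma(E,\delta\text{-}E^{*})}(B)=\delta\text{-}\operatorname{cl}_{\tau}(B)$.
   Context: $K$ is $\mathbb{R}$ or $\mathbb{C}$ with its usual topology. A linear topological space over $K$ is a $K$-vector space with a topology making addition and scalar multiplication continuous (no Hausdorff assumption is stated); it is a locally convex space if it has a local base of convex neighbourhoods of the null vector. In a topological space $X$, a set $U$ is regular open if $U=\operatorname{int}(\operatorname{cl}(U))$; a set $U\subseteq X$ is $\delta$-open if for each $x\in U$ there is a regular open set $P$ with $x\in P\subseteq U$. For $A\subseteq X$, the $\delta$-closure is $\delta\text{-}\operatorname{cl}(A)=\{x\in X:\text{ every }\delta\text{-open set containing }x\text{ intersects }A\}$; $\delta\text{-}\operatorname{cl}_\tau$ denotes the $\delta$-closure in $(E,\tau)$. A map $f:X\to Y$ is $\delta$-continuous if the preimage of every open subset of $Y$ is a $\delta$-open subset of $X$. $\delta\text{-}E^{*}$ is the set of all linear functionals $E\to K$ that are $\delta$-continuous on $(E,\tau)$. The delta weak topology $\sigma(E,\delta\text{-}E^{*})$ is the locally convex topology on $E$ generated by the seminorms $p_f(x)=|f(x)|$, $f\in\delta\text{-}E^{*}$; a local base at the null vector consists of the sets $\bigcap_{i=1}^{n}\{x\in E:|f_i(x)|<r_i\}$ with $n\in\mathbb{N}$, $f_i\in\delta\text{-}E^{*}$,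 $r_i>0$. *)

(* Defs.v *)
From HB Require Import structures.
From mathcomp Require Import all_boot all_order all_algebra complex.
From mathcomp Require Import boolp classical_sets reals topology convex tvs.

Set Implicit Arguments.
Unset Strict Implicit.
Unset Printing Implicit Defensive.

Import Order.TTheory GRing.Theory Num.Theory.
Import numFieldTopology.Exports.

Local Open Scope classical_set_scope.
Local Open Scope ring_scope.

Section delta_notions.
Context {X : topologicalType}.

Definition delta_open (U : set X) : Prop :=
  forall x, U x -> exists P : set X, [/\ regopen P, P x & P `<=` U].

Definition delta_closure (A : set X) : set X :=
  [set x | forall U : set X, delta_open U -> U x -> U `&` A !=set0].

Definition delta_continuous {Y : topologicalType} (f : X -> Y) : Prop :=
  forall V : set Y, open V -> delta_open (f @^-1` V).

End delta_notions.

(* The scalar field carries its norm topology through the alias [K^o]. *)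
Definition delta_dual (K : numFieldType) (E : tvsType K) : set {scalar E} :=
  [set f | delta_continuous (f : E -> K^o)].
Arguments delta_dual {K} E.

(* [weak_space F] is the vector space [E] equipped with the topology generated
   by the seminorms [fun x => `|f x|], [f \in F]. Norms take their values in
   [K] itself, where [0 < r] forces [r] to be real. *)
Definition weak_space (K : numFieldType) (E : lmodType K) (F : set {scalar E})
  : Type := E.

Section weak_space_topology.
Context (K : numFieldType) (E : lmodType K) (F : set {scalar E}).

Definition weak_base0 (n : nat) (f : 'I_n -> {scalar E}) (r : 'I_n -> K)
  : set E := [set x | forall i, `|f i x| < r i].

Definition weak_nbhs (x : E) : set_system E :=
  [set A | exists (n : nat) (f : 'I_n -> {scalar E}) (r : 'I_n -> K),
    [/\ forall i, F (f i), forall i, 0 < r i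
      & [set x + u | u in weak_base0 f r] `<=` A]].

HB.instance Definition _ := Choice.on (weak_space F).
HB.instance Definition _ := GRing.Lmodule.on (weak_space F).
HB.instance Definition _ := hasNbhs.Build (weak_space F) weak_nbhs.

Lemma weak_base0_0 n (f : 'I_n -> {scalar E}) (r : 'I_n -> K) :
  (forall i, 0 < r i) -> weak_base0 f r 0.
Proof. by move=> r0 i; rewrite linear0 normr0. Qed.

Lemma weak_nbhs_singleton (x : E) (A : set E) : weak_nbhs x A -> A x.
Proof.
move=> [n [f [r [_ r0 sA]]]]; apply: sA; exists 0; last exact: addr0.
exact: weak_base0_0.
Qed.

Lemma weak_nbhs_filter (x : E) : ProperFilter (weak_nbhs x).
Proof.
apply: Build_ProperFilter_ex => [A xA|].
  by exists x; exact: weak_nbhs_singleton xA.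
split.
- exists 0%N, (fun=> \0 : {scalar E}), (fun=> 1).
  by split=> [[]|[]|].
- move=> A B [n [f [r [Ff r0 sA]]]] [m [g [s [Fg s0 sB]]]].
  pose h i := match split i with inl j => f j | inr j => g j end.
  pose t i := match split i with inl j => r j | inr j => s j end.
  exists (n + m)%N, h, t; split=> [i|i|_ [u hu <-]].
  + by rewrite /h; case: split.
  + by rewrite /t; case: split.
  + split; [apply: sA|apply: sB]; exists u => // j.
      by have := hu (unsplit (inl j)); rewrite /h /t unsplitK.
    by have := hu (unsplit (inr j)); rewrite /h /t unsplitK.
- move=> A B sAB [n [f [r [Ff r0 sA]]]].
  by exists n, f, r; split=> //; exact: subset_trans sAB.
Qed.

Lemma weak_nbhs_nbhs (x : E) (A : set E) :
  weak_nbhs x A -> weak_nbhs x (weak_nbhs^~ A).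
Proof.
move=> [n [f [r [Ff r0 sA]]]]; exists n, f, r; split=> // _ [u fu <-].
exists n, f, (fun i => r i - `|f i u|); split=> // [i|_ [v fv <-]].
  by rewrite subr_gt0; exact: fu.
apply: sA; exists (u + v); last by rewrite addrA.
move=> i; rewrite linearD (le_lt_trans (ler_normD _ _))// -ltrBrDl.
exact: fv.
Qed.

HB.instance Definition _ := Nbhs_isNbhsTopological.Build (weak_space F)
  weak_nbhs_filter weak_nbhs_singleton weak_nbhs_nbhs.

End weak_space_topology.

Definition delta_weak (K : numFieldType) (E : tvsType K) : topologicalType :=
  weak_space (delta_dual E).

(* Main.v *)
(* A topological vector space is regular even when it is not Hausdorff, so its
   open sets are delta-open; the theorem is thus the equality of the weak and
   the original closure of a convex set [B]. If [x] is not in the closure of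
   [B], a convex neighbourhood [U] of [0] satisfies [b - x \notin U] for all
   [b] in [B]. The gauge of [U] is then at least [t] at [t *: (b - x)], and
   Hahn-Banach gives a linear [g], dominated by the gauge, with
   [1 <= g (b - x)] on [B]; [g] is bounded on a neighbourhood of [0], hence
   continuous. Hahn-Banach itself is obtained from a minimal sublinear
   functional, with no extension from subspaces. Over the complex numbers, [g]
   is the real part of the functional [x |-> g x - i g (i x)]. *)
Require Import Defs.
From HB Require Import structures.
From mathcomp Require Import all_boot all_order all_algebra complex.
From mathcomp Require Import boolp classical_sets reals topology convex tvs.
From mathcomp Require Import interval_inference pseudometric_normed_Zmodule.
From mathcomp Require Import lra.

Local Open Scope classical_set_scope.
Local Open Scope ring_scope.

Set Implicit Arguments.
Unset Strict Implicit.
Unset Printing Implicit Defensive.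

Import Order.TTheory GRing.Theory Num.Theory.

(** * Sublinear functionals and the Hahn-Banach theorem *)

Section sublinear_functionals.
Context {R : realType} {E : lmodType R}.
Implicit Types (p q : E -> R) (x y : E) (T : set (E * R)).

(** Applying the second inequality to [t^-1] gives its converse, so it amounts to positive
    homogeneity. *)
Definition sublinear p :=
  (forall x y, p (x + y) <= p x + p y) /\
  (forall t x, 0 < t -> p (t *: x) <= t * p x).

Lemma sublinear0 p : sublinear p -> p 0 = 0.
Proof.
move=> [pD pZ]; have := pD 0 0; have := pZ 2^-1 0.
rewrite addr0 scaler0 invr_gt0 => /(_ (ltr0n _ _)); lra.
Qed.

Lemma sublinear_lb p q x : sublinear q -> (forall y, q y <= p y) ->
  - p (- x) <= q x.
Proof.
move=> sq qp; have := sq.1 x (- x); rewrite subrr sublinear0//.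
by have := qp (- x); lra.
Qed.

(** For a convex cone [T] with [c.2 <= p c.1] on it, this is the largest sublinear minorant of [p]
    whose value at [- c.1] is at most [- c.2] for every [c] in [T]. A linear functional below it is
    thus at least [c.2] at [c.1]. *)
Definition cone_inf p T y := inf [set p (y + c.1) - c.2 | c in T].

Section cone_inf.
Context {p : E -> R} {T : set (E * R)}.
Hypothesis sp : sublinear p.
Hypothesis T0 : T (0, 0).
Hypothesis TD : forall c d, T c -> T d -> T (c.1 + d.1, c.2 + d.2).
Hypothesis TZ : forall t c, 0 < t -> T c -> T (t *: c.1, t * c.2).
Hypothesis Tp : forall c, T c -> c.2 <= p c.1.

Lemma cone_inf_le y c : T c -> cone_inf p T y <= p (y + c.1) - c.2.
Proof.
move=> Tc; apply: ge_inf; last by exists c.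
(* The infimum is finite: [d.2 <= p d.1 <= p (y + d.1) + p (- y)]. *)
exists (- p (- y)) => _ [d /Tp dp <-].
by have := sp.1 (y + d.1) (- y); rewrite addrAC subrr add0r; lra.
Qed.

Lemma le_cone_inf y m :
  (forall c, T c -> m <= p (y + c.1) - c.2) -> m <= cone_inf p T y.
Proof.
move=> mT; apply: lb_le_inf; first by exists (p (y + 0) - 0), (0, 0).
by move=> _ [c Tc <-]; exact: mT.
Qed.

Lemma sublinear_cone_inf : sublinear (cone_inf p T).
Proof.
split=> [x y|t x t0].
- rewrite -lerBlDl; apply: le_cone_inf => d Td.
  rewrite lerBlDl -lerBlDr; apply: le_cone_inf => c Tc.
  have /= := cone_inf_le (x + y) (TD Tc Td).
  by have := sp.1 (x + c.1) (y + d.1); rewrite addrACA; lra.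
- rewrite -ler_pdivrMl//; apply: le_cone_inf => c Tc.
  rewrite ler_pdivrMl// mulrBr.
  have /= := cone_inf_le (t *: x) (TZ t0 Tc).
  by rewrite -scalerDr; have := sp.2 _ (x + c.1) t0; lra.
Qed.

Lemma cone_inf_le_self y : cone_inf p T y <= p y.
Proof. by have /= := cone_inf_le y T0; rewrite addr0 subr0. Qed.

Lemma cone_inf_opp c : T c -> cone_inf p T (- c.1) <= - c.2.
Proof. by move=> /(cone_inf_le (- c.1)); rewrite addNr sublinear0// sub0r. Qed.

End cone_inf.

(** Zorn's lemma for the sublinear minorants of [p] under the reversed pointwise order; a nonempty
    chain is bounded by its pointwise infimum, which is finite since each member is at least
    [- p (- x)] at [x]. *)
Lemma minimal_sublinear p : sublinear p ->
  exists q, [/\ sublinear q, forall x, q x <= p x &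
    forall q', sublinear q' -> (forall x, q' x <= q x) ->
      forall x, q x <= q' x].
Proof.
move=> sp; pose S := {q : E -> R | sublinear q /\ forall x, q x <= p x}.
pose le_S (a b : S) := `[< forall x, sval b x <= sval a x >].
have leS a b : le_S a b -> forall x, sval b x <= sval a x by move=> /asboolP.
have [|b c d /leS bc /leS cd|A Atot|[q [sq qp]] qmin] :=
    @ZL_preorder S (exist _ p (conj sp (fun x => lexx (p x)))) le_S.
- by move=> b; apply/asboolP.
- by apply/asboolP => x; exact: le_trans (cd x) (bc x).
(* The empty chain is bounded by [p] itself. *)
- have [[a0 Aa0]|A0] := pselect (A !=set0); last first.
    exists (exist _ p (conj sp (fun x => lexx (p x)))) => s As.
    by exfalso; apply: A0; exists s.
  pose q x := inf [set sval a x | a in A].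
  have qle a x : A a -> q x <= sval a x.
    move=> Aa; apply: ge_inf; last by exists a.
    exists (- p (- x)) => _ [[b [sb bp]] _ <-] /=.
    exact: sublinear_lb.
  have q_ge x m : (forall a, A a -> m <= sval a x) -> m <= q x.
    move=> mA; apply: lb_le_inf; first by exists (sval a0 x), a0.
    by move=> _ [a Aa <-]; exact: mA.
  have sq : sublinear q.
    split=> [x y|t x t0].
    + rewrite -lerBlDl; apply/q_ge => b Ab.
      rewrite lerBlDl -lerBlDr; apply/q_ge => a Aa.
      (* The smaller of [a] and [b] serves at both [x] and [y], so its own subadditivity applies. *)
      rewrite lerBlDr; have [/leS ab|/leS ba] := Atot _ _ Aa Ab.
      * have := (svalP b).1.1 x y; have := qle b (x + y) Ab; have := ab x.
        by lra.
      * have := (svalP a).1.1 x y; have := qle a (x + y) Aa; have := ba y.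
        by lra.
    + rewrite -ler_pdivrMl//; apply/q_ge => a Aa.
      rewrite ler_pdivrMl//; apply: le_trans (qle _ _ Aa) _.
      exact: (svalP a).1.2.
  have qp x : q x <= p x.
    by apply: le_trans (qle _ _ Aa0) _; exact: (svalP a0).2.
  by exists (exist _ q (conj sq qp)) => a Aa; apply/asboolP => x /=; exact: qle.
exists q; split=> // q' sq' q'q.
have q'p x : q' x <= p x by exact: le_trans (q'q x) (qp x).
apply: (leS (exist _ q' (conj sq' q'p)) (exist _ q (conj sq qp))).
exact/qmin/asboolP.
Qed.

Lemma sublinear_linear q : sublinear q ->
  (forall x y, q x + q y <= q (x + y)) ->
  exists f : {scalar E}, q = f :> (_ -> _).
Proof.
move=> sq qsup.
have qD x y : q (x + y) = q x + q y.
  by apply/le_anti; rewrite qsup sq.1.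
have qN x : q (- x) = - q x.
  by have := qD x (- x); rewrite subrr sublinear0//; lra.
have qZp t x : 0 < t -> q (t *: x) = t * q x.
  move=> t0; apply/le_anti; rewrite sq.2//=.
  have it0 : 0 < t^-1 by rewrite invr_gt0.
  have := sq.2 _ (t *: x) it0.
  by rewrite scalerA mulVf ?gt_eqF// scale1r ler_pdivlMl.
have qZ t x : q (t *: x) = t * q x.
  have [t0|t0|->] := ltgtP t 0; last 2 first.
  - exact: qZp.
  - by rewrite scale0r mul0r sublinear0.
  by rewrite -[t]opprK scaleNr qN qZp ?oppr_gt0// [RHS]mulNr.
have lq : linear_for *%R q by move=> a u v; rewrite qD qZ.
pose m := GRing.isLinear.Build R E R *%R q lq.
by exists (HB.pack_for {scalar E} q m).
Qed.

(* Among the sublinear minorants of [cone_inf p T], a minimal one is linear,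
   because replacing [q] by [cone_inf q T] for the ray [T] through [(y, q y)]
   does not decrease it. *)
Lemma hahn_banach_cone p T : sublinear p -> T (0, 0) ->
  (forall c d, T c -> T d -> T (c.1 + d.1, c.2 + d.2)) ->
  (forall t c, 0 < t -> T c -> T (t *: c.1, t * c.2)) ->
  (forall c, T c -> c.2 <= p c.1) ->
  exists f : {scalar E}, (forall x, f x <= p x) /\
    (forall c, T c -> c.2 <= f c.1).
Proof.
move=> sp T0 TD TZ Tp.
have [q [sq qp qmin]] := minimal_sublinear (sublinear_cone_inf sp T0 TD TZ Tp).
have [x y|f qf] := sublinear_linear sq.
  pose S := [set c : E * R | exists2 t, 0 <= t & c = (t *: y, t * q y)].
  have S0 : S (0, 0) by exists 0; rewrite // scale0r mul0r.
  have SD c d : S c -> S d -> S (c.1 + d.1, c.2 + d.2).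
    move=> [t t0 ->] [s s0 ->]; exists (t + s); first exact: addr_ge0.
    by rewrite scalerDl mulrDl.
  have SZ t c : 0 < t -> S c -> S (t *: c.1, t * c.2).
    move=> t0 [s s0 ->]; exists (t * s); first by rewrite mulr_ge0// ltW.
    by rewrite /= scalerA mulrA.
  have Sq c : S c -> c.2 <= q c.1.
    move=> [t + ->] /=; rewrite le_eqVlt => /predU1P[<-|t0].
      by rewrite scale0r mul0r sublinear0.
    have it0 : 0 < t^-1 by rewrite invr_gt0.
    have := sq.2 _ (t *: y) it0.
    by rewrite scalerA mulVf ?gt_eqF// scale1r ler_pdivlMl.
  (* Minimality gives [q x <= cone_inf q S x <= q (x + y) - q y], which is superadditivity. *)
  have := qmin _ (sublinear_cone_inf sq S0 SD SZ Sq)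
    (cone_inf_le_self sq S0 Sq) x.
  have S1 : S (y, q y) by exists 1; rewrite // scale1r mul1r.
  by have /= := cone_inf_le sq Sq x S1; lra.
exists f; rewrite -qf; split=> [x|c Tc].
  exact: le_trans (qp x) (cone_inf_le_self sp T0 Tp x).
have := le_trans (qp _) (cone_inf_opp sp Tp Tc).
by rewrite qf linearN lerN2.
Qed.

End sublinear_functionals.

(** * Convex sets, their gauge, and separation *)

Lemma convex_setP (K : numDomainType) (M : lmodType K) (A : set M) :
  convex_set A <-> forall t x y, 0 <= t -> t <= 1 -> A x -> A y ->
    A (t *: x + (1 - t) *: y).
Proof.
split=> [cA t x y t0 t1 /mem_set xA /mem_set yA|cA x y t].
  exact: (set_mem (cA _ _ (Itv01 t0 t1) xA yA)).
by move=> /set_mem xA /set_mem yA; apply/mem_set/cA.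
Qed.

Section gauge.
Context {R : realType} {E : lmodType R}.
Variable U : set E.
Hypothesis cU : convex_set U.
Hypothesis U0 : U 0.
Hypothesis Uabs : forall y, exists2 t, 0 < t & U (t *: y).

Definition gauge y := inf [set t | 0 < t /\ U (t^-1 *: y)].

Lemma gauge_le t y : 0 < t -> U (t^-1 *: y) -> gauge y <= t.
Proof. by move=> t0 Uty; apply: ge_inf => //; exists 0 => s [/ltW]. Qed.

Lemma le_gauge m y :
  (forall t, 0 < t -> U (t^-1 *: y) -> m <= t) -> m <= gauge y.
Proof.
move=> my; apply: lb_le_inf => [|t [t0 Uty]]; last exact: my.
by have [t t0 Uty] := Uabs y; exists t^-1; rewrite /= invr_gt0 invrK.
Qed.

Lemma sublinear_gauge : sublinear gauge.
Proof.
split=> [x y|t x t0].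
- rewrite -lerBlDl; apply: le_gauge => s s0 Usy.
  rewrite lerBlDl -lerBlDr; apply: le_gauge => t t0 Utx.
  rewrite lerBlDr; apply: gauge_le; first exact: addr_gt0.
  have ts0 : 0 < t + s by exact: addr_gt0.
  (* [(t + s)^-1 *: (x + y)] is the convex combination of [t^-1 *: x] and [s^-1 *: y] with weights
     [t / (t + s)] and [s / (t + s)]. *)
  have r0 : 0 <= t / (t + s) by rewrite divr_ge0 ?ltW.
  have r1 : t / (t + s) <= 1 by rewrite ler_pdivrMr// mul1r lerDl ltW.
  have := (convex_setP U).1 cU _ _ _ r0 r1 Utx Usy; congr U.
  have -> : 1 - t / (t + s) = s / (t + s).
    by rewrite -{1}(@divff _ (t + s)) ?gt_eqF// -mulrBl addrAC subrr add0r.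
  rewrite !scalerA ![_ / (t + s)]mulrC -!mulrA !divff ?gt_eqF// mulr1.
  by rewrite -scalerDr.
- rewrite -ler_pdivrMl//; apply: le_gauge => s s0 Usx.
  rewrite ler_pdivrMl//; apply: gauge_le; first exact: mulr_gt0.
  by rewrite scalerA invfM mulrAC mulVf ?gt_eqF// mul1r.
Qed.

Lemma gauge_le1 y : U y -> gauge y <= 1.
Proof. by move=> Uy; apply: gauge_le; rewrite // invr1 scale1r. Qed.

Lemma gauge_ge1 y : ~ U y -> 1 <= gauge y.
Proof.
move=> nUy; apply: le_gauge => t t0 Uty; rewrite leNgt; apply/negP => t1.
apply: nUy.
(* For [t < 1], [y] lies on the segment from [0] to [t^-1 *: y]. *)
have := (convex_setP U).1 cU _ _ _ (ltW t0) (ltW t1) Uty U0.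
by rewrite scaler0 addr0 scalerA divff ?gt_eqF// scale1r.
Qed.

End gauge.

Lemma convex_separation (R : realType) (E : lmodType R) (U B : set E) (x : E) :
  convex_set U -> U 0 -> (forall y, exists2 t, 0 < t & U (t *: y)) ->
  convex_set B -> (forall b, B b -> ~ U (b - x)) ->
  exists f : {scalar E}, (forall u, U u -> f u <= 1) /\
    (forall b, B b -> 1 <= f (b - x)).
Proof.
move=> cU U0 Uabs cB BU.
have [[b0 Bb0]|B0] := pselect (B !=set0); last first.
  exists \0; split=> [u _|b Bb]; first exact: ler01.
  by exfalso; apply: B0; exists b.
(* The cone generated by the pairs [(b - x, 1)]; convexity of [B] makes it closed under addition. *)
pose T := [set c : E * R | exists t b,
  [/\ 0 <= t, B b & c = (t *: (b - x), t)]].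
have sg := sublinear_gauge cU Uabs.
have [|c d|t c t0|c|f [fU fT]] := hahn_banach_cone (T := T) sg.
- by exists 0, b0; rewrite scale0r.
- move=> [t [b [t0 Bb ->]]] [s [b' [s0 Bb' ->]]] /=.
  (* The weights [t / (t + s)] and [s / (t + s)] are meaningless at the apex of the cone, where any
     point of [B] will do. *)
  have [ts0|ts0] := eqVneq (t + s) 0.
    have [-> ->] : t = 0 /\ s = 0 by split; lra.
    by exists 0, b; rewrite !scale0r !addr0.
  have ts : 0 < t + s by rewrite lt_neqAle eq_sym ts0 addr_ge0.
  have r0 : 0 <= t / (t + s) by rewrite divr_ge0// ltW.
  have r1 : t / (t + s) <= 1 by rewrite ler_pdivrMr// mul1r lerDl.
  exists (t + s), (t / (t + s) *: b + (1 - t / (t + s)) *: b').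
  split; [exact: ltW|exact: (convex_setP B).1|].
  have rE : (t + s) * (t / (t + s)) = t by rewrite mulrCA divff// mulr1.
  congr pair; rewrite [RHS]scalerBr [in RHS]scalerDr !scalerA mulrBr mulr1 rE.
  by rewrite [t + s - t]addrC addKr scalerDl opprD addrACA -!scalerBr.
- move=> [s [b [s0 Bb ->]]]; exists (t * s), b.
  by rewrite scalerA; split=> //; rewrite mulr_ge0// ltW.
- move=> [t [b [+ Bb ->]]] /=; rewrite le_eqVlt => /predU1P[<-|t0].
    by rewrite scale0r sublinear0.
  have it0 : 0 < t^-1 by rewrite invr_gt0.
  have := sg.2 _ (t *: (b - x)) it0.
  rewrite scalerA mulVf ?gt_eqF// scale1r ler_pdivlMl// => /(le_trans _); apply.
  by rewrite ler_peMr ?(ltW t0)// gauge_ge1//; exact: BU.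
exists f; split=> [u Uu|b Bb]; first exact: le_trans (fU u) (gauge_le1 Uu).
by apply: (fT (b - x, 1)); exists 1, b; rewrite scale1r.
Qed.

(** * Delta-open sets and delta-closure in uniform spaces *)

Lemma delta_openE {X : uniformType} : delta_open = @open X.
Proof.
apply/funext => U; apply/propext; split=> [dU|oU x Ux].
  rewrite openE => x /dU[P [rP Px PU]]; rewrite /interior nbhsE.
  exists P => //; split=> //; rewrite -rP; exact: open_interior.
(* By regularity [U] contains the closure of a neighbourhood [V] of [x], and the interior of a
   closed set is regular open. *)
have [V Vx VU] := uniform_regular (open_nbhs_nbhs (conj oU Ux)).
exists (closure V)°; split.
- exact/interior_closed_regopen/closed_closure.
- exact: filterS (@subset_closure _ V) Vx.
- exact: subset_trans (@interior_subset _ _) VU.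
Qed.

Lemma delta_closureE {X : uniformType} : delta_closure = @closure X.
Proof.
apply/funext => A; apply/seteqP; split=> x Ax.
  move=> V; rewrite nbhsE => -[W [oW Wx] WV].
  have [y [Ay Wy]] : W `&` A !=set0 by apply: Ax => //; rewrite delta_openE.
  by exists y; split=> //; exact: WV.
move=> U; rewrite delta_openE => oU Ux; rewrite setIC; apply: Ax.
exact: open_nbhs_nbhs.
Qed.

(** * Continuous functionals and the delta weak closure *)

Section delta_tvs.
Context {K : numFieldType} {E : tvsType K}.
Implicit Types (A B U V W : set E) (x y : E).

Lemma delta_dualE (f : {scalar E}) :
  delta_dual E f <-> continuous (f : E -> K^o).
Proof.
rewrite continuousP /delta_dual /= /delta_continuous delta_openE.
by split.
Qed.

(** This is continuity of scalar multiplication at [(0, y)]. *)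
Lemma nbhs0_absorbing U y : nbhs (0 : E) U -> exists2 t : K, 0 < t & U (t *: y).
Proof.
move=> U0; have := @scale_continuous K E (0, y) U.
rewrite /= scale0r => /(_ U0) [[A B] /= [[e /= e0 eA] By] AB].
exists (e / 2); first by rewrite divr_gt0.
apply: (AB (e / 2, y)); split; last exact: nbhs_singleton.
apply: eA; rewrite /= sub0r normrN gtr0_norm ?divr_gt0//.
by rewrite ltr_pdivrMr// ltr_pMr// ltr1n.
Qed.

Lemma locally_bounded_scalar_continuous (f : {scalar E}) W (M : K) :
  nbhs (0 : E) W -> 0 < M -> (forall u, W u -> `|f u| <= M) ->
  continuous (f : E -> K^o).
Proof.
move=> W0 M0 fW x; apply/(@cvgrPdist_lt _ K^o) => e e0.
(* Scaling [W] by [e / (2 * M)] brings the bound [M] down to [e / 2], strictly below [e]. *)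
have e2M : e / (2 * M) != 0 by rewrite gt_eqF// divr_gt0// mulr_gt0.
apply: filterS (nbhsT x (nbhs0Z e2M W0)) => _ [_ [u Wu <-] <-].
rewrite linearD opprD addrA subrr sub0r normrN linearZ/= normrM.
rewrite gtr0_norm; last by rewrite divr_gt0// mulr_gt0.
apply: (@le_lt_trans _ _ (e / (2 * M) * M)).
  by rewrite ler_wpM2l ?fW// ltW// divr_gt0// mulr_gt0.
by rewrite invfM mulrA mulfVK ?gt_eqF// ltr_pdivrMr// ltr_pMr// ltr1n.
Qed.

Lemma notin_closure_convex_nbhs B x : ~ closure B x -> exists U,
  [/\ convex_set U, nbhs (0 : E) U & forall b, B b -> ~ U (b - x)].
Proof.
move=> nBx; have [V Vx VB] : exists2 V, nbhs x V & V `&` B = set0.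
  apply: contrapT => nV; apply: nBx => V Vx; rewrite setIC.
  by apply/set0P/eqP => VB; apply: nV; exists V.
have [S cS [oS bS]] := @locally_convex K E.
have [C [SC Cx] CV] := bS x V Vx.
(* [C] is a convex basic neighbourhood of [x] inside [V], hence disjoint from [B]; it is translated
   to the origin. *)
exists [set u | C (x + u)]; split.
- apply/convex_setP => t u v t0 t1 /= Cu Cv.
  have := (convex_setP C).1 (cS _ (mem_set SC)) _ _ _ t0 t1 Cu Cv; congr C.
  by rewrite !scalerDr addrACA -scalerDl subrKC scale1r.
- have Cn : nbhs x C by apply: open_nbhs_nbhs; split=> //; exact: oS.
  have := nbhsB (- x) Cn; rewrite addNr; apply: filterS => _ [u Cu <-].
  by rewrite /= addNKr.
- move=> b Bb /=; rewrite subrKC => /CV Vb.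
  by have : (V `&` B) b by []; rewrite VB.
Qed.

Lemma closure_delta_weak B :
  (forall x, ~ closure B x -> exists2 f, delta_dual E f &
     forall b, B b -> 1 <= `|f (b - x)|) ->
  @closure (delta_weak E) B = delta_closure B.
Proof.
move=> sepB; rewrite delta_closureE; apply/seteqP; split=> x Bx.
  apply: contrapT => /sepB[f df fB].
  (* The weak neighbourhood of radius [1] given by [f] alone misses [B]. *)
  have /Bx[y [/fB fy [u fu xuy]]] : weak_nbhs (delta_dual E) x
      [set x + u | u in @weak_base0 K E 1 (fun=> f) (fun=> 1)].
    by exists 1%N, (fun=> f), (fun=> 1); split.
  have := lt_le_trans (fu ord0) fy.
  by rewrite -xuy addrAC subrr add0r ltxx.
move=> A [n [f [r [df r0 fA]]]]; apply: Bx.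
(* Conversely, delta-continuous functionals are continuous, so weak neighbourhoods are
   neighbourhoods in the original topology. *)
suff /(nbhsT x) : nbhs (0 : E) (weak_base0 f r) by exact: filterS.
apply: filter_forall => i; have := (delta_dualE (f i)).1 (df i) 0.
move=> /(@cvgrPdist_lt _ K^o) /(_ _ (r0 i)); apply: filterS => y.
by rewrite linear0 sub0r normrN.
Qed.

End delta_tvs.

(** * Separation over the real field *)

Lemma nbhs0_symmetric (K : numDomainType) (E : tvsType K) (U : set E) :
  nbhs 0 U -> nbhs 0 [set u | U u /\ U (- u)].
Proof.
move=> U0; apply: filterI => //.
by apply: filterS (nbhs0N U0) => _ [u Uu <-] /=; rewrite opprK.
Qed.

Lemma real_continuous_separation (R : realType) (E : tvsType R) (B : set E)
    (x : E) : convex_set B -> ~ closure B x ->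
  exists2 f, delta_dual E f & forall b, B b -> 1 <= `|f (b - x)|.
Proof.
move=> cB /notin_closure_convex_nbhs[U [cU U0 UB]].
have [f [fU fB]] := convex_separation cU (nbhs_singleton U0)
  (fun y => nbhs0_absorbing y U0) cB UB.
exists f => [|b /fB /le_trans]; last by apply; exact: ler_norm.
apply/delta_dualE.
(* The bound [f u <= 1] is one-sided on [U]; it becomes a bound on the absolute value where [- u] is
   in [U] too. *)
apply: (locally_bounded_scalar_continuous (nbhs0_symmetric U0) ltr01).
move=> u [/fU fu /fU fNu]; rewrite ler_norml fu andbT.
by rewrite linearN in fNu; rewrite lerNl.
Qed.

(* An alias, so that [E] can carry its real scaling beside the complex one. *)
Definition realified (R : realType) (E : lmodType R[i]) : Type := E.

(** * Real and complex functionals; separation over the complex field *)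

Section realified.
Context {R : realType} {E : lmodType R[i]}.

HB.instance Definition _ := GRing.Zmodule.on (realified E).

Let real_scale (a : R) (x : realified E) : realified E :=
  real_complex _ a *: (x : E).

Let real_scaleA a b x : real_scale a (real_scale b x) = real_scale (a * b) x.
Proof. by rewrite /real_scale scalerA -rmorphM. Qed.

Let real_scale1 : left_id 1 real_scale.
Proof. by move=> x; rewrite /real_scale rmorph1 scale1r. Qed.

Let real_scaleDr : right_distributive real_scale +%R.
Proof. by move=> a x y; rewrite /real_scale scalerDr. Qed.

Let real_scaleDl x : {morph real_scale^~ x : a b / a + b}.
Proof. by move=> a b; rewrite /real_scale rmorphD scalerDl. Qed.

HB.instance Definition _ := GRing.Zmodule_isLmodule.Build R (realified E)
  real_scaleA real_scale1 real_scaleDr real_scaleDl.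

Lemma convex_realified (A : set E) :
  convex_set A -> @convex_set R (realified E) A.
Proof.
move=> /convex_setP cA; apply/convex_setP => t x y t0 t1 Ax Ay.
have := cA (real_complex _ t) x y; rewrite ler0c -(rmorph1 (real_complex R)).
by rewrite lecR -rmorphB; apply.
Qed.

Lemma complexify (g : {scalar (realified E)}) :
  exists f : {scalar E}, forall x, f x = (g x +i* - g ('i%C *: (x : E)))%C.
Proof.
pose f (x : E) : R[i] := (g x +i* - g ('i%C *: x : E))%C.
have gE (a b : R) (u : E) :
    g ((a +i* b)%C *: u) = a * g u + b * g ('i%C *: u).
  have -> : (a +i* b)%C *: u = (a *: (u : realified E) +
      b *: ('i%C *: u : realified E) : realified E).
    rewrite [RHS](_ : _ =
      real_complex R a *: u + real_complex R b *: ('i%C *: u))//.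
    by rewrite scalerA -scalerDl; congr (_ *: _); simpc.
  by rewrite linearD !linearZ.
have gD (u v : E) : g (u + v) = g u + g v by exact: (linearD g).
have lf : linear_for *%R f.
  move=> [a b] u v; rewrite /f scalerDr scalerA.
  (* With this product [gE] also computes the imaginary part of [f]. *)
  have -> : 'i%C * (a +i* b)%C = (- b +i* a)%C :> R[i] by simpc.
  rewrite !gD (gE a b) (gE (- b) a).
  have mulDE (c d e k : R) :
    ((a +i* b) * (c +i* d) + (e +i* k) =
     (a * c - b * d + e) +i* (a * d + b * c + k))%C by [].
  by rewrite mulDE; congr (_ +i* _)%C; lra.
pose m := GRing.isLinear.Build R[i] E R[i] *%R f lf.
by exists (HB.pack_for {scalar E} f m).
Qed.

End realified.

Lemma complex_continuous_separation (R : realType) (E : tvsType R[i])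
    (B : set E) (x : E) : convex_set B -> ~ closure B x ->
  exists2 f, delta_dual E f & forall b, B b -> 1 <= `|f (b - x)|.
Proof.
move=> cB /notin_closure_convex_nbhs[U [cU U0 UB]].
have Uabs (y : realified E) : exists2 t : R, 0 < t & U (t *: y).
  have [[t s]] := nbhs0_absorbing y U0.
  (* A positive complex number is real, so complex absorption gives real absorption. *)
  by rewrite ltcE /= => /andP[/eqP -> t0] Uty; exists t.
have [g [gU gB]] := @convex_separation R (realified E) U B x
  (convex_realified cU) (nbhs_singleton U0) Uabs (convex_realified cB) UB.
have [f fg] := complexify g.
exists f => [|b /gB gb]; last first.
  apply: le_trans (normc_ge_Re _); rewrite fg /= lecR.
  exact: le_trans gb (ler_norm _).
have gW u : U u /\ U (- u) -> `|g u| <= 1.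
  move=> [/gU gu /gU gNu]; rewrite ler_norml gu andbT.
  by rewrite linearN in gNu; rewrite lerNl.
have Ni0 : - 'i%C != 0 :> R[i] by rewrite oppr_eq0 eq_complex /= oner_eq0 andbF.
pose W := [set u | U u /\ U (- u)].
have W0 : nbhs (0 : E) W := nbhs0_symmetric U0.
(* For [u] in this neighbourhood both [u] and ['i *: u] lie in [W], so the real and imaginary parts
   of [f u] are at most [1] in absolute value, and its modulus is at most [2]. *)
apply/delta_dualE/(@locally_bounded_scalar_continuous _ _ _
  (W `&` *:%R (- 'i%C) @` W) 2) => //.
  by apply: filterI => //; exact: nbhs0Z.
move=> u [Wu [w Ww wu]]; rewrite fg.
have -> : 'i%C *: u = w.
  by rewrite -wu scalerA mulrN -expr2 sqr_i opprK scale1r.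
rewrite normc_def /= -(rmorph_nat (real_complex R) 2) lecR.
rewrite -[leRHS]ger0_norm ?ler0n// -sqrtr_sqr ler_wsqrtr//.
move: (gW u Wu) (gW w Ww); rewrite !ler_norml => /andP[? ?] /andP[? ?]; nra.
Qed.

Theorem theorem3p22 (R : realType) :
  (forall (E : tvsType R) (B : set E),
     convex_set B ->
     @closure (delta_weak E) B = @delta_closure E B) /\
  (forall (E : tvsType (complex R)) (B : set E),
     convex_set B ->
     @closure (delta_weak E) B = @delta_closure E B).
Proof.
split=> E B cB; apply: closure_delta_weak => x.
- exact: real_continuous_separation.
- exact: complex_continuous_separation.
Qed.
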